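(* Let $A$ be a commutative ring, $\mathfrak{a}$ an ideal of $A$, $M$ an $A$-module, and $\{ m_z \}_{z \in Z}$ a collection of elements of $M$ indexed by a set $Z$. Assume $A$ and $M$ are $\mathfrak{a}$-adically complete. Write $A_0 := A/\mathfrak{a}$, $M_0 := A_0 \otimes_A M$, and let $\pi_0 : M \to M_0$ be the canonical homomorphism. Then the following two conditions are equivalent: (i) The collection $\{ \pi_0(m_z) \}_{z \in Z}$ generates the $A_0$-module $M_0$. (ii) The collection $\{ m_z \}_{z \in Z}$ $\mathfrak{a}$-adically generates $M$.
   Context: An $A$-module $N$ is $\mathfrak{a}$-adically complete if the canonical homomorphism $N \to \varprojlim_i (N/\mathfrak{a}^{i+1}N)$ is bijective. For $a \in A$ put $\operatorname{ord}_{\mathfrak{a}}(a) := \sup\{ i \in \mathbb{N} \mid a \in \mathfrak{a}^i \} \in \mathbb{N}\cup\{\infty\}$. A function $g : Z \to A$ is decaying if for every $i \in \mathbb{N}$ the set $\{ z \in Z \mid \operatorname{ord}_{\mathfrak{a}}(g(z)) \leq i\}$ is finite. If $g$ is decaying, the series $\sum_{z \in Z} g(z) m_z$ converges $\mathfrak{a}$-adically to a unique element of $M$; here $m = \sum_{z\in Z} f(z)$ (for $f: Z \to M$) means that for every $i \in \mathbb{N}$ there is a finite subset $Z_i \subset Z$ with $m - \sum_{z \in Z_i} f(z) \in \mathfrak{a}^{i+1}M$ and $f(z) \in \mathfrak{a}^{i+1}M$ for all $z \notin Z_i$. The collection $\{m_z\}_{z\in Z}$ $\mathfrak{a}$-adically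 generates $M$ if for every $m \in M$ there exists a decaying function $g : Z \to A$ such that $m = \sum_{z \in Z} g(z) m_z$. *)

(* Defs.v *)
From HB Require Import structures.
From mathcomp Require Import all_boot all_order all_algebra.
From mathcomp Require Import generic_quotient ring_quotient finmap.
From mathcomp Require Import boolp classical_sets functions cardinality.
From mathcomp Require Import constructive_ereal.

Set Implicit Arguments.
Unset Strict Implicit.
Unset Printing Implicit Defensive.

Import Order.TTheory GRing.Theory Num.Theory.
Local Open Scope ring_scope.
Local Open Scope quotient_scope.

(* Rings are [comPzRingType]s, so the zero ring and the unit ideal are allowed
   (ring_quotient's [idealr] only covers proper ideals of nonzero rings).
   An ideal of A is a submodule of the regular module [A^o]. *)
Notation ideal A := (submodClosed (A^o)).

Section FullSubmodule.
Variables (A : pzRingType) (V : lmodType A).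

Definition fullm : {pred V} := predT.

Lemma fullm_submod_closed : submod_closed fullm.
Proof. by []. Qed.

HB.instance Definition _ :=
  GRing.isSubmodClosed.Build A V fullm fullm_submod_closed.
End FullSubmodule.
Arguments fullm {A} V.

Section IdealSubmoduleProduct.
Variables (A : comPzRingType) (I : ideal A) (V : lmodType A).
Variable N : submodClosed V.

(* I N: the finite sums of products a *: n with a in I and n in N. *)
Definition ismul : {pred V} := fun v =>
  `[< exists2 s : seq (A * V),
        all (fun p => (p.1 \in I) && (p.2 \in N)) s
      & v = \sum_(p <- s) p.1 *: p.2 >].

Lemma ismul_submod_closed : submod_closed ismul.
Proof.
split=> [|a u v /asboolP [s sI ->] /asboolP [t tI ->]]; apply/asboolP.
  by exists [::]; rewrite ?big_nil.
exists ([seq (a * p.1, p.2) | p <- s] ++ t).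
  rewrite all_cat tI andbT all_map; apply: sub_all sI => p /= /andP[p1 ->].
  by rewrite andbT; apply: (rpredZ a p1).
rewrite big_cat big_map scaler_sumr; congr (_ + _).
by apply: eq_bigr => p _; rewrite scalerA.
Qed.

HB.instance Definition _ :=
  GRing.isSubmodClosed.Build A V ismul ismul_submod_closed.
End IdealSubmoduleProduct.

Fixpoint idealX (A : comPzRingType) (I : ideal A) (n : nat) : ideal A :=
  if n is n'.+1 then ismul I (idealX I n') else fullm A^o.

Section AdicSubmodule.
Variables (A : comPzRingType) (I : ideal A) (V : lmodType A).

Definition adicm (n : nat) : submodClosed V := ismul (idealX I n) (fullm V).

Lemma idealX_succ_sub n : {subset idealX I n.+1 <= idealX I n}.
Proof.
move=> x /asboolP[s /allP sI ->]; rewrite big_seq rpred_sum // => p ps.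
by have /andP[_ ?] := sI p ps; apply: rpredZ.
Qed.

Lemma adicm_succ_sub n : {subset adicm n.+1 <= adicm n}.
Proof.
move=> x /asboolP[s sI ->]; apply/asboolP; exists s => //.
by apply: sub_all sI => p /andP[/idealX_succ_sub-> ->].
Qed.
End AdicSubmodule.

Section QuotientModule.
Variables (A : pzRingType) (V : lmodType A) (N : submodClosed V).

(* [submodClosed] is defined over semirings, hence does not inherit from
   [zmodClosed], which [Quotient.quot] requires. *)
Definition submod_pred : {pred V} := fun v => v \in N.

Lemma submod_pred_zmod_closed : zmod_closed submod_pred.
Proof. exact: GRing.submod_closedB (submodClosedP N). Qed.
HB.instance Definition _ :=
  GRing.isZmodClosed.Build V submod_pred submod_pred_zmod_closed.

Definition quotm : Type := Quotient.quot submod_pred.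
HB.instance Definition _ := GRing.Zmodule.on quotm.

Definition quotm_proj (v : V) : quotm := \pi_(Quotient.quot submod_pred) v.
Definition quotm_repr (x : quotm) : V := repr (x : Quotient.quot submod_pred).

Lemma quotm_reprK x : quotm_proj (quotm_repr x) = x.
Proof. exact: reprK. Qed.

Lemma quotm_projP u v : reflect (quotm_proj u = quotm_proj v) (u - v \in N).
Proof.
rewrite -[_ \in N]/(u - v \in submod_pred) Quotient.idealrBE; exact: eqP.
Qed.

Lemma quotm_proj_zmod_morphism : zmod_morphism quotm_proj.
Proof. by move=> u v; rewrite /quotm_proj raddfB. Qed.
HB.instance Definition _ :=
  GRing.isZmodMorphism.Build V quotm quotm_proj quotm_proj_zmod_morphism.

Definition quotm_scale (a : A) (x : quotm) : quotm :=
  quotm_proj (a *: quotm_repr x).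

Lemma quotm_scaleE a v : quotm_scale a (quotm_proj v) = quotm_proj (a *: v).
Proof.
apply/quotm_projP; rewrite -scalerBr rpredZ //.
by apply/quotm_projP; rewrite quotm_reprK.
Qed.

Lemma quotm_scalerA a b x :
  quotm_scale a (quotm_scale b x) = quotm_scale (a * b) x.
Proof. by rewrite -[x]quotm_reprK !quotm_scaleE scalerA. Qed.

Lemma quotm_scale1r : left_id 1 quotm_scale.
Proof. by move=> x; rewrite -[x]quotm_reprK quotm_scaleE scale1r. Qed.

Lemma quotm_scalerDr : right_distributive quotm_scale +%R.
Proof.
move=> a x y; rewrite -[x]quotm_reprK -[y]quotm_reprK.
by rewrite -raddfD !quotm_scaleE -raddfD scalerDr.
Qed.

Lemma quotm_scalerDl x : {morph quotm_scale^~ x : a b / a + b}.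
Proof.
by move=> a b; rewrite -[x]quotm_reprK !quotm_scaleE scalerDl raddfD.
Qed.

HB.instance Definition _ := GRing.Zmodule_isLmodule.Build A quotm
  quotm_scalerA quotm_scale1r quotm_scalerDr quotm_scalerDl.

Lemma quotm_proj_scalable : scalable quotm_proj.
Proof. by move=> a v; rewrite -quotm_scaleE. Qed.
HB.instance Definition _ :=
  GRing.isScalable.Build A V quotm *:%R quotm_proj quotm_proj_scalable.
End QuotientModule.

Section QuotientRing.
Variables (A : comPzRingType) (I : ideal A).

Definition quotr : Type := @quotm A (A^o) I.
HB.instance Definition _ := GRing.Zmodule.on quotr.

Definition quotr_proj (a : A) : quotr := @quotm_proj A (A^o) I a.
Definition quotr_mul (x y : quotr) : quotr :=
  quotr_proj (quotm_repr x * quotm_repr y).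

Lemma quotr_mulE a b :
  quotr_mul (quotr_proj a) (quotr_proj b) = quotr_proj (a * b).
Proof.
have reprB c : quotm_repr (quotr_proj c) - c \in I.
  by apply/quotm_projP; rewrite quotm_reprK.
apply/quotm_projP.
set a' := quotm_repr (quotr_proj a); set b' := quotm_repr (quotr_proj b).
have -> : (a' * b' : A) - a * b = b' * (a' - a) + a * (b' - b).
  by rewrite !mulrBr addrA (mulrC b' a') (mulrC b' a) subrK.
by apply: rpredD; apply: rpredZ; apply: reprB.
Qed.

Lemma quotr_reprK (x : quotr) : quotr_proj (quotm_repr x) = x.
Proof. exact: quotm_reprK. Qed.

Lemma quotr_projD a b : quotr_proj (a + b) = quotr_proj a + quotr_proj b.
Proof. exact: (raddfD (@quotm_proj A (A^o) I)). Qed.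

Lemma quotr_mulA : associative quotr_mul.
Proof.
move=> x y z; rewrite -[x]quotr_reprK -[y]quotr_reprK -[z]quotr_reprK.
by rewrite !quotr_mulE mulrA.
Qed.

Lemma quotr_mulC : commutative quotr_mul.
Proof.
move=> x y; rewrite -[x]quotr_reprK -[y]quotr_reprK.
by rewrite !quotr_mulE mulrC.
Qed.

Lemma quotr_mul1r : left_id (quotr_proj 1) quotr_mul.
Proof. by move=> x; rewrite -[x]quotr_reprK quotr_mulE mul1r. Qed.

Lemma quotr_mulDl : left_distributive quotr_mul +%R.
Proof.
move=> x y z; rewrite -[x]quotr_reprK -[y]quotr_reprK -[z]quotr_reprK.
by rewrite -quotr_projD !quotr_mulE mulrDl quotr_projD.
Qed.

Lemma quotr_mulr1 : right_id (quotr_proj 1) quotr_mul.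
Proof. by move=> x; rewrite quotr_mulC quotr_mul1r. Qed.

Lemma quotr_mulDr : right_distributive quotr_mul +%R.
Proof. by move=> x y z; rewrite !(quotr_mulC x) quotr_mulDl. Qed.

HB.instance Definition _ := GRing.Zmodule_isPzRing.Build quotr
  quotr_mulA quotr_mul1r quotr_mulr1 quotr_mulDl quotr_mulDr.
HB.instance Definition _ :=
  GRing.PzRing_hasCommutativeMul.Build quotr quotr_mulC.

Lemma quotr_proj_zmod_morphism : zmod_morphism quotr_proj.
Proof. exact: (raddfB (@quotm_proj A (A^o) I)). Qed.
Lemma quotr_proj_monoid_morphism : monoid_morphism quotr_proj.
Proof. by split=> // a b; rewrite -quotr_mulE. Qed.
HB.instance Definition _ :=
  GRing.isZmodMorphism.Build A quotr quotr_proj quotr_proj_zmod_morphism.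
HB.instance Definition _ :=
  GRing.isMonoidMorphism.Build A quotr quotr_proj quotr_proj_monoid_morphism.
End QuotientRing.

Section BaseChange.
Variables (A B : comPzRingType) (f : {rmorphism A -> B}) (M : lmodType A).

(* B \otimes_A M: a tensor is a formal sum of pairs (b, m), i.e. a sequence,
   modulo the congruence generated by commutativity of formal sums and
   A-balanced biadditivity.  Formal sums have no formal inverses, whence the
   rule (0, m) = 0; the inverse of (b, m) is then (- b, m). *)
Inductive tens_eq : seq (B * M) -> seq (B * M) -> Prop :=
| TensRefl s : tens_eq s s
| TensSym s t : tens_eq s t -> tens_eq t s
| TensTrans s t u : tens_eq s t -> tens_eq t u -> tens_eq s u
| TensCat s s' t t' : tens_eq s s' -> tens_eq t t' -> tens_eq (s ++ t) (s' ++ t')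
| TensCatC s t : tens_eq (s ++ t) (t ++ s)
| Tens0l m : tens_eq [:: (0, m)] [::]
| TensDl b b' m : tens_eq [:: (b + b', m)] [:: (b, m); (b', m)]
| TensDr b m m' : tens_eq [:: (b, m + m')] [:: (b, m); (b, m')]
| TensZ a b m : tens_eq [:: (f a * b, m)] [:: (b, a *: m)].

Definition tens_rel (s t : seq (B * M)) : bool := `[< tens_eq s t >].

Lemma tens_rel_equiv : equiv_class_of tens_rel.
Proof.
split=> [s|s t|t s u]; first by apply/asboolP/TensRefl.
  by apply/asboolP/asboolP => /TensSym.
by move=> /asboolP st /asboolP tu; apply/asboolP/(TensTrans st tu).
Qed.

Canonical tens_equiv := EquivRelPack tens_rel_equiv.
Canonical tens_encModRel := defaultEncModRel tens_rel.

Definition base_change : Type := {eq_quot tens_rel}.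
HB.instance Definition _ := Choice.on base_change.

Definition tens_class (s : seq (B * M)) : base_change :=
  \pi_({eq_quot tens_rel}) s.
Definition tens_repr (x : base_change) : seq (B * M) :=
  repr (x : {eq_quot tens_rel}).

Lemma tens_classP s t : tens_class s = tens_class t <-> tens_eq s t.
Proof.
split=> [/eqP|st]; first by rewrite /tens_class piE => /asboolP.
by apply/eqP; rewrite /tens_class piE; apply/asboolP.
Qed.

Lemma tens_reprK x : tens_class (tens_repr x) = x.
Proof. exact: reprK. Qed.

Lemma tens_reprE s : tens_eq (tens_repr (tens_class s)) s.
Proof. by apply/tens_classP; rewrite tens_reprK. Qed.

Definition tens_add (x y : base_change) : base_change :=
  tens_class (tens_repr x ++ tens_repr y).
Definition tens_scale (c : B) (x : base_change) : base_change :=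
  tens_class [seq (c * p.1, p.2) | p <- tens_repr x].

Lemma tens_addE s t : tens_add (tens_class s) (tens_class t) = tens_class (s ++ t).
Proof. by apply/tens_classP; apply: TensCat; apply: tens_reprE. Qed.

Lemma tens_eq_scale c s t : tens_eq s t ->
  tens_eq [seq (c * p.1, p.2) | p <- s] [seq (c * p.1, p.2) | p <- t].
Proof.
elim=> {s t} /=.
- by move=> s; apply: TensRefl.
- by move=> s t _; apply: TensSym.
- by move=> s t u _ st _ tu; apply: TensTrans st tu.
- by move=> s s' t t' _ ss' _ tt'; rewrite !map_cat; apply: TensCat.
- by move=> s t; rewrite !map_cat; apply: TensCatC.
- by move=> m; rewrite mulr0; apply: Tens0l.
- by move=> b b' m; rewrite mulrDr; apply: TensDl.
- by move=> b m m'; apply: TensDr.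
- by move=> a b m; rewrite mulrCA; apply: TensZ.
Qed.

Lemma tens_scaleE c s :
  tens_scale c (tens_class s) = tens_class [seq (c * p.1, p.2) | p <- s].
Proof. by apply/tens_classP; apply/tens_eq_scale/tens_reprE. Qed.

Lemma tens_addA : associative tens_add.
Proof.
move=> x y z; rewrite -[x]tens_reprK -[y]tens_reprK -[z]tens_reprK.
by rewrite !tens_addE catA.
Qed.

Lemma tens_addC : commutative tens_add.
Proof. by move=> x y; apply/tens_classP/TensCatC. Qed.

Lemma tens_add0 : left_id (tens_class [::]) tens_add.
Proof. by move=> x; rewrite -[x]tens_reprK tens_addE. Qed.

Lemma tens_scalerDl x :
  {morph tens_scale^~ x : c d / c + d >-> tens_add c d}.
Proof.
move=> c d; rewrite -[x]tens_reprK; move: (tens_repr x) => s.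
rewrite !tens_scaleE tens_addE; apply/tens_classP.
elim: s => [|[b m] s IHs] /=; first exact: TensRefl.
have h1 := TensCat (TensDl (c * b) (d * b) m) IHs.
rewrite -mulrDl /= in h1; apply: TensTrans h1 _.
set S := [seq (c * p.1, p.2) | p <- s]; set T := [seq (d * p.1, p.2) | p <- s].
apply: (TensCat (TensRefl [:: (c * b, m)])).
have := TensCat (TensCatC [:: (d * b, m)] S) (TensRefl T).
by rewrite -!catA.
Qed.

Lemma tens_addN : left_inverse (tens_class [::]) (tens_scale (-1)) tens_add.
Proof.
have scale0 y : tens_scale 0 y = tens_class [::].
  rewrite -[y]tens_reprK tens_scaleE; apply/tens_classP.
  elim: (tens_repr y) => [|[b m] s IHs] /=; first exact: TensRefl.
  by rewrite mul0r; apply: (TensCat (Tens0l m) IHs).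
move=> x; have {2}<- : tens_scale 1 x = x.
  rewrite -[x]tens_reprK tens_scaleE; congr tens_class.
  by rewrite -[RHS]map_id; apply: eq_map => -[b m]; rewrite mul1r.
by rewrite -tens_scalerDl addNr scale0.
Qed.

HB.instance Definition _ := GRing.isZmodule.Build base_change
  tens_addA tens_addC tens_add0 tens_addN.

Lemma tens_scalerA c d x :
  tens_scale c (tens_scale d x) = tens_scale (c * d) x.
Proof.
rewrite -[x]tens_reprK !tens_scaleE -map_comp; congr tens_class.
by apply: eq_map => p /=; rewrite mulrA.
Qed.

Lemma tens_scale1r : left_id 1 tens_scale.
Proof.
move=> x; rewrite -[x]tens_reprK tens_scaleE; congr tens_class.
by rewrite -[RHS]map_id; apply: eq_map => -[b m]; rewrite mul1r.
Qed.

Lemma tens_scalerDr : right_distributive tens_scale +%R.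
Proof.
move=> c x y; rewrite -[x]tens_reprK -[y]tens_reprK.
by rewrite [_ + _]tens_addE !tens_scaleE map_cat [RHS]tens_addE.
Qed.

HB.instance Definition _ := GRing.Zmodule_isLmodule.Build B base_change
  tens_scalerA tens_scale1r tens_scalerDr tens_scalerDl.

Definition tens (b : B) (m : M) : base_change := tens_class [:: (b, m)].
End BaseChange.

Lemma base_change_universal (A B : comPzRingType) (f : {rmorphism A -> B})
  (M : lmodType A) (N : lmodType B) (g : M -> N)
  (gD : {morph g : x y / x + y}) (gZ : forall a m, g (a *: m) = f a *: g m) :
  exists h : {linear base_change f M -> N},
   (forall m, h (tens f 1 m) = g m) /\
   forall h' : {linear base_change f M -> N}, (forall m, h' (tens f 1 m) = g m) -> h =1 h'.
Proof.
pose F (s : seq (B * M)) := \sum_(p <- s) p.1 *: g p.2.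
have FE s t : tens_eq f s t -> F s = F t.
  elim=> {s t}; rewrite /F //.
  - by move=> s t u _ -> _ ->.
  - by move=> s s' t t' _ h _ h'; rewrite !big_cat /= h h'.
  - by move=> s t; rewrite !big_cat /= addrC.
  - by move=> m; rewrite big_seq1 big_nil scale0r.
  - by move=> b b' m; rewrite big_seq1 big_cons big_seq1 scalerDl.
  - by move=> b m m'; rewrite big_seq1 big_cons big_seq1 /= gD scalerDr.
  - by move=> a b m; rewrite !big_seq1 /= gZ scalerA mulrC.
pose h (x : base_change f M) : N := F (tens_repr x).
have hE s : h (tens_class f s) = F s by apply/FE/tens_reprE.
have hL : linear h.
  move=> c x y; rewrite -[x]tens_reprK -[y]tens_reprK [c *: _]tens_scaleE [_ + _]tens_addE !hE /F big_cat big_map /= scaler_sumr.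
  by congr (_ + _); apply: eq_bigr => p _; rewrite scalerA.
pose hm := GRing.isLinear.Build B _ N *:%R h hL.
pose H : {linear base_change f M -> N} := HB.pack h hm.
have H1 m : H (tens f 1 m) = g m.
  by rewrite /= -/(h _) hE /F big_seq1 scale1r.
exists H; split => // h' h'1 x.
rewrite -[x]tens_reprK; elim: (tens_repr x) => [|[b m] s IH].
  by rewrite -[tens_class f [::]]/(0 : base_change f M) !linear0.
have -> : tens_class f ((b, m) :: s) = b *: tens f 1 m + tens_class f s.
  by rewrite [_ *: _]tens_scaleE [_ + _]tens_addE /= mulr1.
by rewrite !linearP H1 h'1 IH.
Qed.

Section AdicNotions.
Variables (A : comPzRingType) (I : ideal A).

Definition adic_quot (N : lmodType A) (i : nat) : lmodType A :=
  quotm (adicm I N i.+1).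

Definition adic_proj (N : lmodType A) (i : nat) : N -> adic_quot N i :=
  @quotm_proj A N (adicm I N i.+1).

Definition adic_trans (N : lmodType A) (i : nat) (x : adic_quot N i.+1) :
  adic_quot N i := adic_proj i (quotm_repr x).

(* The inverse limit of the N / I^(i+1) N: compatible sequences. *)
Record adic_lim (N : lmodType A) := AdicLim {
  adic_lim_seq :> forall i, adic_quot N i;
  adic_lim_compat : forall i, adic_trans (adic_lim_seq i.+1) = adic_lim_seq i
}.

Lemma adic_transE (N : lmodType A) (i : nat) (n : N) :
  adic_trans (adic_proj i.+1 n) = adic_proj i n.
Proof.
by apply/quotm_projP/adicm_succ_sub/quotm_projP; rewrite quotm_reprK.
Qed.

Definition adic_canon (N : lmodType A) (n : N) : adic_lim N :=
  AdicLim (fun i => adic_transE i n).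

Definition adically_complete (N : lmodType A) : Prop :=
  bijective (@adic_canon N).

Local Open Scope classical_set_scope.

(* N \cup {oo} is embedded in [\bar int]; the supremum is never negative
   because the set contains 0, I^0 being all of A. *)
Definition adic_ord (a : A) : \bar int :=
  supremum 0%E [set (i%:Z)%:E | i in [set i : nat | a \in idealX I i]].

Definition decaying (Z : Type) (g : Z -> A) : Prop :=
  forall i : nat, finite_set [set z | (adic_ord (g z) <= (i%:Z)%:E)%E].

Definition adic_sum (M : lmodType A) (Z : choiceType) (f : Z -> M) (m : M) :=
  forall i : nat, exists2 Zi : {fset Z},
    m - \sum_(z <- Zi) f z \in adicm I M i.+1
    & forall z, z \notin Zi -> f z \in adicm I M i.+1.

Definition adically_generates (M : lmodType A) (Z : choiceType) (m_ : Z -> M) :=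
  forall m : M, exists2 g : Z -> A,
    decaying g & adic_sum (fun z => g z *: m_ z) m.

(* M_0 = A_0 \otimes_A M and the canonical map x |-> 1 \otimes x *)
Definition residue_module (M : lmodType A) : lmodType (quotr I) :=
  base_change (@quotr_proj A I) M.

Definition residue_proj (M : lmodType A) (m : M) : residue_module M :=
  tens (@quotr_proj A I) 1 m.
End AdicNotions.

Definition generates (R : pzRingType) (V : lmodType R) (Z : Type) (v : Z -> V) :=
  forall x : V, exists s : seq (R * Z), x = \sum_(p <- s) p.1 *: v p.2.

Lemma idealX_le (A : comPzRingType) (I : ideal A) m n : (m <= n)%N -> {subset idealX I n <= idealX I m}.
Proof. elim: n => [|n IH]; first by rewrite leqn0 => /eqP->.
by rewrite leq_eqVlt => /predU1P[->//|/IH h] x /idealX_succ_sub/h. Qed.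

Lemma adic_ord_le (A : comPzRingType) (I : ideal A) (a : A) (i : nat) :
  (adic_ord I a <= (i%:Z)%:E)%E = (a \notin idealX I i.+1).
Proof.
rewrite /adic_ord; set S := (X in supremum _ X).
have S0 : S 0%E by exists 0%N.
have nS: S != set0 by apply/set0P; exists 0%E.
have E x : supremums S x -> supremum 0%E S = x.
  move=> Sx; rewrite /supremum (negPf nS); case: xgetP => [y _ Sy|/(_ x)//].
  exact: (is_subset1_supremums Sy Sx).
case: (pselect (forall n, a \in idealX I n)) => [h|/existsNP[n hn]].
  rewrite h (E +oo%E) //; split; first by move=> y _; rewrite leey.
  move=> [r| |] ub //.
  - have Sr : S (`|r|%N.+1%:Z)%:E by exists (`|r|%N.+1); [exact: h|].
    have := ub _ Sr.
    rewrite lee_fin => h1; have := le_trans h1 (ler_norm r); by rewrite -abszE lez_nat ltnn.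
  - by have := ub _ S0.
have exn : exists k, a \notin idealX I k by exists n; apply/negP.
case: (ex_minnP exn) => -[|k] hk hmin; first by case/negP: hk.
have -> : supremum 0%E S = (k%:Z)%:E.
  apply: E; split.
    move=> _ [j /= aj <-]; rewrite lee_fin lez_nat leqNgt; apply/negP => kj.
    by move/negP: hk; apply; apply: (idealX_le kj).
  move=> y; apply; exists k => //=; apply/negPn/negP => /hmin; by rewrite ltnn.
rewrite lee_fin lez_nat; apply/idP/idP => [ki|/hmin//].
by apply: contra hk => /(@idealX_le _ _ k.+1)->.
Qed.

(* Main.v *)
Require Import Defs.
From mathcomp Require Import all_boot all_algebra.
From mathcomp Require Import finmap boolp cardinality.

(** The easy direction, from (ii) to (i), is truncation: the series of an
    element [m] agrees with a finite partial sum modulo [I M], the map [M -> M_0]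
    kills [I M], and it is surjective ([residue_proj_surj]).

    For the converse, [M_0] is [M / I M] ([residue_projP]), so (i) says that every
    element of [M] is a finite combination of the [m_z] up to an error in [I M].
    Multiplying by [I^n], every element of [I^n M] is a combination of the [m_z]
    with coefficients in [I^n], up to an error in [I^(n+1) M]
    ([adicm_approx]).  Applying this repeatedly to the successive errors, starting
    from [m], produces finite combinations [T n] of the [m_z] such that [m - T n]
    lies in [I^n M] and the coefficients of [T n] and [T n.+1] differ by elements
    of [I^n] ([adic_approximations]).  As [A] is complete, the coefficients of
    each [m_z] converge to some [g z], which is congruent to the coefficient in
    [T n.+1] modulo [I^(n+1)] ([adic_limit]).  Only finitely many [z] occur in
    [T n.+1]; for all the others [g z] lies in [I^(n+1)].  Hence [g] is decaying
    and its series sums to [m]. *)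

Set Implicit Arguments.
Unset Strict Implicit.
Unset Printing Implicit Defensive.

Import GRing.Theory.
Local Open Scope ring_scope.

(** * Powers of an ideal and adic limits *)

Section AdicFiltration.
Variables (A : comPzRingType) (I : ideal A).

Lemma ismulM (V : lmodType A) (J : ideal A) (N : submodClosed V) (a : A) (v : V) :
  a \in J -> v \in N -> a *: v \in ismul J N.
Proof.
move=> aJ vN; apply/asboolP; exists [:: (a, v)]; first by rewrite /= aJ vN.
by rewrite big_seq1.
Qed.

Lemma ismul_fullm (J : ideal A) (a : A) : (a \in ismul J (fullm A^o)) = (a \in J).
Proof.
apply/idP/idP => [/asboolP[s /allP sJ ->]|aJ].
  rewrite big_seq; apply: (@rpred_sum A^o) => p /sJ /andP[pJ _].
  by rewrite [_ *: _]mulrC; exact: (@rpredZ A A^o J p.2 p.1 pJ).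
by rewrite -[a]mulr1; apply: (@ismulM A^o J (fullm A^o) a 1).
Qed.

Lemma idealX1 (a : A) : (a \in idealX I 1) = (a \in I).
Proof. exact: ismul_fullm. Qed.

Lemma adicm_regular (n : nat) (a : A) : (a \in adicm I A^o n) = (a \in idealX I n).
Proof. exact: ismul_fullm. Qed.

Lemma adicmM (V : lmodType A) (n : nat) (a : A) (v : V) :
  a \in idealX I n -> a *: v \in adicm I V n.
Proof. by move=> aI; apply: ismulM. Qed.

Lemma idealX_adicm1 (V : lmodType A) (n : nat) (a : A) (v : V) :
  a \in idealX I n -> v \in adicm I V 1 -> a *: v \in adicm I V n.+1.
Proof.
move=> aI /asboolP[s /allP sI ->]; rewrite scaler_sumr big_seq rpred_sum // => p.
move=> /sI /andP[p1 _]; rewrite scalerA; apply: adicmM.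
by rewrite mulrC; apply: ismulM; first by rewrite -idealX1.
Qed.

(** The congruences hold for the powers of [I] themselves, not for their
    closures, because the limit is compared with [N / I^(i+1) N] for each [i]. *)
Lemma adic_limit (N : lmodType A) (u : nat -> N) :
  adically_complete I N ->
  (forall i, u i.+1 - u i \in adicm I N i.+1) ->
  exists l, forall i, l - u i \in adicm I N i.+1.
Proof.
move=> [inv _ invK] du.
have uC i : adic_trans (adic_proj I i.+1 (u i.+1)) = adic_proj I i (u i).
  by rewrite adic_transE; apply/quotm_projP.
exists (inv (AdicLim uC)) => i; apply/quotm_projP.
by have := congr1 (fun L : adic_lim I N => L i) (invK (AdicLim uC)).
Qed.

End AdicFiltration.

(** * The residue module as the quotient of [M] by [I M] *)

Section ResidueModule.
Variables (A : comPzRingType) (I : ideal A) (M : lmodType A).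
Local Notation pi0 := (@residue_proj A I M).
Local Notation rho := (@quotr_proj A I).

Lemma residue_projD : {morph pi0 : m n / m + n}.
Proof. by move=> m n; rewrite [RHS]tens_addE; apply/tens_classP/TensDr. Qed.

Lemma residue_projZ a m : pi0 (a *: m) = rho a *: pi0 m.
Proof.
rewrite [RHS]tens_scaleE /=; apply/tens_classP/TensSym.
exact: (@TensZ _ _ (@quotr_proj A I)).
Qed.

Lemma residue_proj0 : pi0 0 = 0.
Proof. by apply: (addrI (pi0 0)); rewrite -residue_projD !addr0. Qed.

Lemma residue_projB : {morph pi0 : m n / m - n}.
Proof. by move=> m n; apply: (addIr (pi0 n)); rewrite -residue_projD !subrK. Qed.

Lemma residue_proj_sum (K : Type) (s : seq (A * K)) (v : K -> M) :
  pi0 (\sum_(p <- s) p.1 *: v p.2) = \sum_(p <- s) rho p.1 *: pi0 (v p.2).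
Proof.
rewrite (big_morph _ residue_projD residue_proj0).
by apply: eq_bigr => p _; rewrite residue_projZ.
Qed.

(** [rho] is surjective, so the scalars of a tensor can be moved to its
    right-hand side. *)
Lemma residue_proj_surj (x : residue_module I M) : exists m, x = pi0 m.
Proof.
rewrite -[x]tens_reprK; elim: (tens_repr x) => [|[b n] s [m sm]].
  by exists 0; rewrite residue_proj0.
exists (quotm_repr b *: n + m); rewrite residue_projD residue_projZ -sm.
by rewrite quotr_reprK [_ *: _]tens_scaleE /= mulr1 [RHS]tens_addE.
Qed.

(** The inclusion of the kernel in [I M] follows from the well-definedness of
    the map [M_0 -> M / I M] that sends the class of [a] tensor [m] to the class
    of [a m]: it is checked below on each generator of the tensor congruence. *)
Lemma residue_projP m n : reflect (pi0 m = pi0 n) (m - n \in adicm I M 1).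
Proof.
apply: (iffP idP) => [/asboolP[s /allP sI mn]|].
  apply/eqP; rewrite -subr_eq0 -residue_projB; apply/eqP.
  rewrite mn (residue_proj_sum s id) big_seq big1 // => p /sI /andP[p1 _].
  have -> : rho p.1 = 0; last by rewrite scale0r.
  by rewrite -(rmorph0 rho); apply/quotm_projP; rewrite subr0 -idealX1.
pose q := @quotm_proj A M (adicm I M 1).
have qZ a b v : rho a = rho b -> q (a *: v) = q (b *: v).
  move=> /quotm_projP ab; apply/quotm_projP; rewrite -scalerBl.
  by apply: adicmM; rewrite idealX1.
have qr a v : q (quotm_repr (rho a) *: v) = q (a *: v).
  by apply: qZ; apply: quotr_reprK.
pose F (s : seq (quotr I * M)) := \sum_(p <- s) q (quotm_repr p.1 *: p.2).
have FE s t : tens_eq rho s t -> F s = F t.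
  elim=> {s t}; rewrite /F //.
  - by move=> s t u _ -> _ ->.
  - by move=> s s' t t' _ h _ h'; rewrite !big_cat /= h h'.
  - by move=> s t; rewrite !big_cat /= addrC.
  - move=> v; rewrite big_seq1 big_nil /= -[0 in LHS](rmorph0 rho) qr scale0r.
    exact: raddf0.
  - move=> b b' v; rewrite big_seq1 big_cons big_seq1 /=.
    rewrite -{1}[b]quotr_reprK -{1}[b']quotr_reprK -(rmorphD rho) qr scalerDl.
    exact: raddfD.
  - move=> b v w; rewrite big_seq1 big_cons big_seq1 /= scalerDr; exact: raddfD.
  - move=> a b v; rewrite !big_seq1 /= -{1}[b]quotr_reprK -(rmorphM rho) qr.
    by rewrite scalerA mulrC.
have F1 v : F [:: (1, v)] = q v.
  by rewrite /F big_seq1 /= -[1 in LHS](rmorph1 rho) qr scale1r.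
by move=> /tens_classP /FE; rewrite !F1 => /quotm_projP.
Qed.

End ResidueModule.

(** * Finite combinations and successive approximation *)

Section Combinations.
Variables (A : comPzRingType) (Z : choiceType).

Definition coef (s : seq (A * Z)) (z : Z) : A := \sum_(p <- s | p.2 == z) p.1.

Lemma coef_cat s t z : coef (s ++ t) z = coef s z + coef t z.
Proof. exact: big_cat. Qed.

Lemma coef_out s z : z \notin [seq p.2 | p <- s] -> coef s z = 0.
Proof.
move=> zs; rewrite /coef big_seq_cond big1 // => p /andP[ps /eqP pz].
by case/negP: zs; rewrite -pz map_f.
Qed.

Lemma coef_in (J : ideal A) s z : all (fun p => p.1 \in J) s -> coef s z \in J.
Proof.
move=> /allP sJ; rewrite /coef big_seq_cond.
by apply: (@rpred_sum A^o) => p /andP[/sJ].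
Qed.

Variables (M : lmodType A) (m_ : Z -> M).

Definition comb (s : seq (A * Z)) : M := \sum_(p <- s) p.1 *: m_ p.2.

Lemma comb_cat s t : comb (s ++ t) = comb s + comb t.
Proof. exact: big_cat. Qed.

Lemma comb_coef (s : seq (A * Z)) :
  comb s = \sum_(z <- [fset p.2 | p in s]%fset) coef s z *: m_ z.
Proof.
under [RHS]eq_bigr do rewrite /coef scaler_suml.
rewrite (exchange_big_dep xpredT) //= /comb big_seq [RHS]big_seq.
apply: eq_bigr => p ps.
have pZ : p.2 \in [fset p.2 | p in s]%fset by apply: in_imfset.
rewrite (eq_bigl (pred1 p.2)) => [|z]; last by rewrite /= eq_sym.
by rewrite -big_filter filter_pred1_uniq ?fset_uniq // big_seq1.
Qed.

Variable I : ideal A.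
Hypothesis m_gen : generates (fun z => residue_proj I (m_ z)).

Lemma residue_approx m : exists s, m - comb s \in adicm I M 1.
Proof.
have [s ms] := m_gen (residue_proj I m).
exists [seq (quotm_repr p.1, p.2) | p <- s]; apply/residue_projP.
rewrite ms residue_proj_sum big_map; apply: eq_bigr => p _ /=.
by rewrite quotr_reprK.
Qed.

Lemma adicm_approx n m : m \in adicm I M n ->
  exists2 s, all (fun p => p.1 \in idealX I n) s & m - comb s \in adicm I M n.+1.
Proof.
move=> /asboolP[t tI ->]; elim: t tI => [|[c v] t IHt] /=.
  by exists [::] => //; rewrite /comb !big_nil subrr rpred0.
move=> /andP[/andP[cI _] /IHt[s sI st]].
have [r vr] := residue_approx v.
exists ([seq (c * p.1, p.2) | p <- r] ++ s).
  rewrite all_cat sI andbT; apply/allP => _ /mapP[p _ ->] /=.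
  by rewrite mulrC; exact: (@rpredZ A A^o (idealX I n) p.1 c cI).
have -> : comb ([seq (c * p.1, p.2) | p <- r] ++ s) = c *: comb r + comb s.
  rewrite comb_cat /comb big_map scaler_sumr; congr (_ + _).
  by apply: eq_bigr => p _; rewrite scalerA.
rewrite big_cons /= opprD addrACA -scalerBr rpredD //; exact: idealX_adicm1.
Qed.

(** Each correction is appended to the previous list, so the change of a
    coefficient from one stage to the next is its coefficient in the correction
    alone, hence lies in [I^n]. *)
Lemma adic_approximations m : exists T : nat -> seq (A * Z),
  (forall n, m - comb (T n) \in adicm I M n) /\
  (forall n z, coef (T n.+1) z - coef (T n) z \in idealX I n).
Proof.
(* The membership is an implication inside the existential so that [choice]
   yields a total function, which the recursion below can call before the
   invariant [mT] is known. *)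
have /choice[step stepP] (x : nat * M) : exists s, x.2 \in adicm I M x.1 ->
    all (fun p => p.1 \in idealX I x.1) s /\ x.2 - comb s \in adicm I M x.1.+1.
  have [/adicm_approx[s sI ms]|nx] := boolP (x.2 \in adicm I M x.1).
    by exists s.
  by exists [::].
pose T := fix T n :=
  if n is n'.+1 then T n' ++ step (n', m - comb (T n')) else [::].
have TE n : T n.+1 = T n ++ step (n, m - comb (T n)) by [].
have mT n : m - comb (T n) \in adicm I M n.
  elim: n => [|n IHn]; first by rewrite -[_ - _]scale1r; apply: adicmM.
  have [_] := stepP (n, m - comb (T n)) IHn.
  by rewrite TE comb_cat opprD addrA.
exists T; split=> // n z.
have [sI _] := stepP (n, m - comb (T n)) (mT n).
by rewrite TE coef_cat addrC addKr; apply: coef_in.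
Qed.

Lemma adically_generates_of_residue :
  adically_complete I A^o -> adically_generates I m_.
Proof.
move=> hA m; have [T [mT dT]] := adic_approximations m.
have /choice[g gT] z : exists l, forall i, l - coef (T i.+1) z \in idealX I i.+1.
  have regE i x := @adicm_regular A I i.+1 (x - coef (T i.+1) z).
  have [i|l lP] := @adic_limit A I A^o (fun i => coef (T i.+1) z) hA.
    exact: etrans (regE _ _) (dT i.+1 z).
  by exists l => i; apply: etrans (esym (regE i l)) (lP i).
pose S i := [fset p.2 | p in T i.+1]%fset.
have g_out i z : z \notin S i -> g z \in idealX I i.+1.
  move=> zS; have := gT z i; rewrite coef_out ?subr0 //.
  apply: contra zS => /mapP[p pT ->]; exact: in_imfset.
exists g => i.
  apply: (sub_finite_set _ (finite_fset (S i))) => z /=.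
  by rewrite adic_ord_le; apply: contraNT => /g_out.
exists (S i) => [|z /g_out]; last exact: adicmM.
have -> : m - \sum_(z <- S i) g z *: m_ z = m - comb (T i.+1)
    - \sum_(z <- S i) (g z - coef (T i.+1) z) *: m_ z.
  rewrite comb_coef -/(S i) -addrA -opprD -big_split; congr (_ - _).
  by apply: eq_bigr => z _; rewrite /= -scalerDl addrC subrK.
by rewrite rpredB ?mT // rpred_sum // => z _; apply: adicmM.
Qed.

End Combinations.

Lemma residue_generates_of_adic (A : comPzRingType) (I : ideal A)
    (M : lmodType A) (Z : choiceType) (m_ : Z -> M) :
  adically_generates I m_ -> generates (fun z => residue_proj I (m_ z)).
Proof.
move=> m_gen x; have [m ->] := residue_proj_surj x.
have [g _ /(_ 0)[Z0 /residue_projP mE _]] := m_gen m.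
exists [seq (quotr_proj I (g z), z) | z <- Z0].
have := residue_proj_sum I [seq (g z, z) | z <- Z0] m_.
by rewrite !big_map -mE => ->.
Qed.

Theorem theorem2p11 (A : comPzRingType) (I : ideal A) (M : lmodType A)
    (Z : choiceType) (m_ : Z -> M)
    (hA : adically_complete I A^o) (hM : adically_complete I M) :
  generates (fun z => residue_proj I (m_ z)) <-> adically_generates I m_.
Proof.
split=> [m_gen|]; first exact: adically_generates_of_residue.
exact: residue_generates_of_adic.
Qed.
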